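(* Let $m<\omega$. If $(p_n)_{n<\omega}$ is a discrete sequence of relatively ordinal RK-$m$-minimal free ultrafilters on $\omega$ and $p$ is an RK-minimal free ultrafilter on $\omega$, then $\int_p p_n$ is relatively ordinal RK-$(m+1)$-minimal.
   Context: For $f:\omega\to\omega$ and a filter $p$ on $\omega$, $f(p)=\{B: f^{-1}(B)\in p\}$. For ultrafilters, $p\ge_{RK}q$ if $f(p)\supseteq q$ for some $f$; $p\approx q$ if $p\ge_{RK}q$ and $q\ge_{RK}p$. A free ultrafilter $u$ is RK-minimal if for every $f:\omega\to\omega$, $f(u)$ is principal or $f(u)\approx u$. A sequence $(p_n)$ of filters is discrete if there are pairwise disjoint sets $U_n\in p_n$. For filters $p,p_n$ on $\omega$, $\int_p p_n=\bigcup_{P\in p}\bigcap_{n\in P}p_n$. For an ordinal $\gamma$, an ultrafilter $u$ on $\omega$ is a $J_\gamma$-ultrafilter if for every $f:\omega\to\omega_1$ there is $U\in u$ such that $f(U)$ has order type $<\gamma$; $J^*_\gamma$ denotes the class of $J_\gamma$-ultrafilters which are not $J_\delta$-ultrafilters for any $\delta<\gamma$. An ultrafilter $u\in J^*_{\omega^\alpha}$ is relatively ordinal RK-$\alpha$-minimal if for every $f:\omega\to\omega$ either $u\approx f(u)$ or $f(u)\in J^*_{\omega^\beta}$ for some $\beta<\alpha$. *)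

(* Defs.v *)
From Stdlib Require Import Wellfounded Wf_nat.
From HB Require Import structures.
From mathcomp Require Import all_boot all_order.
From mathcomp Require Import boolp classical_sets functions cardinality filter.
From mathcomp Require wochoice.

Set Implicit Arguments.
Unset Strict Implicit.
Unset Printing Implicit Defensive.

Import Order.TTheory.
Local Open Scope classical_set_scope.
Local Open Scope order_scope.

(* Isomorphic well-orders stand for the same ordinal; every notion below is
   invariant under isomorphism. *)
Record ord := Ord {
  ord_disp : Order.disp_t ;
  ord_sort :> orderType ord_disp ;
  ord_wf : well_founded (fun x y : ord_sort => x < y) }.

(* [a] is isomorphic to a proper initial segment of [b]. *)
Definition ord_lt (a b : ord) : Prop :=
  exists (c : b) (h : a -> b),
    {mono h : x y / x < y} /\ range h = [set z | z < c].

Lemma nat_ord_wf (n : nat) : well_founded (fun i j : 'I_n => i < j).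
Proof.
apply: (well_founded_lt_compat _ (@nat_of_ord n)) => x y xy.
by apply/ssrnat.ltP.
Qed.

Definition nat_ord (n : nat) : ord := Ord (@nat_ord_wf n).

Section OrderType.
Variables (d : Order.disp_t) (T : orderType d) (A : set T).

Definition subset_order : Type := {x : T | x \in A}.

HB.instance Definition _ := SubChoice.on subset_order.
HB.instance Definition _ :=
  [SubChoice_isSubOrder of subset_order by <: with d].

Lemma order_type_wf : well_founded (fun x y : T => x < y) ->
  well_founded (fun x y : subset_order => x < y).
Proof.
move=> wfT.
apply: (wf_incl _ _ (fun x y : subset_order => val x < val y)) => [x y|].
  by rewrite lt_val.
exact: (wf_inverse_image _ _ (fun x y : T => x < y) val wfT).
Qed.

End OrderType.

Definition order_type (W : ord) (A : set W) : ord :=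
  Ord (order_type_wf (A := A) (@ord_wf W)).

Section OmegaPow.
Variables (d : Order.disp_t) (T : orderType d).

(* Cantor normal form: the non-increasing sequence [:: a_1; ...; a_k] stands
   for omega^a_1 + ... + omega^a_k, and ordinals are compared
   lexicographically. *)
Definition cnf : Type := {s : seqlexi T | sorted >=%O (s : seq T)}.

HB.instance Definition _ := SubChoice.on cnf.
HB.instance Definition _ := [SubChoice_isSubOrder of cnf by <: with d].

Let R (s t : seqlexi T) : Prop :=
  [/\ sorted >=%O (s : seq T), sorted >=%O (t : seq T) & s < t].

Let Rwf : well_founded (fun x y : T => x < y) ->
  forall s : seqlexi T, sorted >=%O (s : seq T) -> Acc R s.
Proof.
move=> wfT.
have Acc0 : Acc R [::] by constructor=> -[|b r] [].
have main a : forall s : seq T, path >=%O a s -> Acc R s.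
  elim/(well_founded_ind wfT): a => a IHa.
  have step (s : seqlexi T) : Acc R s -> path >=%O a (s : seq T) ->
      Acc R (a :: s : seqlexi T).
    elim=> {}s _ IHs pas; constructor=> -[|b r] [sr _].
      by constructor=> -[|c t] [].
    rewrite ltxi_cons => /andP[].
    rewrite le_eqVlt => /orP[/eqP ba|ba _]; last first.
      by apply: (IHa b ba); rewrite /= lexx.
    rewrite ba lexx /= => rs; rewrite /= ba in sr.
    apply: IHs => //; split=> //.
      exact: path_sorted sr.
    exact: path_sorted pas.
  elim=> [_|x r IHr]; first exact: Acc0.
  move=> /andP[xa pxr]; have [ax|ax] := eqVneq x a.
    move: pxr; rewrite ax => pxr.
    exact (step r (IHr pxr) pxr).
  have {}xa : x < a by rewrite lt_neqAle ax.
  by apply: (IHa x xa); rewrite /= lexx.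
case=> [_|x r pxr]; first exact: Acc0.
by apply: (main x); rewrite /= lexx.
Qed.

Lemma cnf_wf : well_founded (fun x y : T => x < y) ->
  well_founded (fun x y : cnf => x < y).
Proof.
move=> wfT s; have := Rwf wfT (valP s).
move e : (val s) => t At; elim: At s e => {}t _ IH s st.
constructor=> r rs; apply: (IH (val r)) => //; split; first exact: valP.
  by rewrite -st; exact: valP.
by rewrite -st lt_val.
Qed.

End OmegaPow.

Definition omega_pow (a : ord) : ord := Ord (cnf_wf (@ord_wf a)).

(* A fixed well-ordering of the uncountable set of all subsets of nat; omega_1
   is its set of points with countably many predecessors. *)
Definition wo_powerset : Type := set nat.

Section WoPowerset.

Let wr : rel {classic set nat} :=
  projT1 (wochoice.well_ordering_principle {classic set nat}).

Let wrP : wochoice.well_order wr :=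
  projT2 (wochoice.well_ordering_principle {classic set nat}).

Let wr_chain : wochoice.wo_chain wr predT.
Proof. by move=> A _ neA; apply: wrP. Qed.

Let wr_anti : antisymmetric wr.
Proof. by move=> x y; apply: (wochoice.wo_chain_antisymmetric wr_chain). Qed.

Let wr_total : total wr.
Proof. by move=> x y; apply: (wochoice.wo_chainW wr_chain). Qed.

Let wr_refl : reflexive wr.
Proof. by move=> x; have := wr_total x x; rewrite orbb. Qed.

Let wr_trans : transitive wr.
Proof.
move=> y x z xy yz.
have [w [[/or3P wA wm] _]] : exists! w, wochoice.minimum_of wr
    (fun t => [|| t == x, t == y | t == z]) w.
  by apply: wrP; exists x; rewrite unfold_in eqxx.
have wx : wr w x by apply: wm; rewrite unfold_in eqxx.
have wy : wr w y by apply: wm; rewrite unfold_in eqxx orbT.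
have wz : wr w z by apply: wm; rewrite unfold_in eqxx !orbT.
case: wA => /eqP e; subst w => //.
  by rewrite (@wr_anti x y) // xy.
by rewrite (@wr_anti y z) ?yz // in xy.
Qed.

HB.instance Definition _ := Choice.copy wo_powerset {classic set nat}.
HB.instance Definition _ := Order.Le_isPOrder.Build (Order.Disp tt tt)
  wo_powerset wr_refl wr_anti wr_trans.
HB.instance Definition _ := Order.POrder_isTotal.Build (Order.Disp tt tt)
  wo_powerset wr_total.

Lemma wo_powerset_wf : well_founded (fun x y : wo_powerset => x < y).
Proof.
move=> x; apply: contrapT => nx.
have [w [[wA wm] _]] : exists! w, wochoice.minimum_of wr
    (fun t => `[< ~ Acc (fun x y : wo_powerset => x < y) t >]) w.
  by apply: wrP; exists x; apply/asboolP.
move/asboolP: wA; apply; constructor => y yw; apply: contrapT => ny.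
have : (w : wo_powerset) <= y by apply: wm; apply/asboolP.
by rewrite leNgt yw.
Qed.

End WoPowerset.

Definition omega1 : ord :=
  @order_type (Ord wo_powerset_wf) [set x | countable [set y | y < x]].

Lemma omega1_below_countable (x : omega1) : countable [set y : omega1 | y < x].
Proof.
have /set_mem/= /countable_injP[f fi] := valP x.
apply/countable_injP; exists (fun y => f (val y)) => y z /set_mem yx /set_mem zx.
by move/fi => e; apply/val_inj/e; apply/mem_set; [exact: yx | exact: zx].
Qed.

Lemma omega1_uncountable : ~ countable [set: omega1].
Proof.
set A := [set x : wo_powerset | countable [set y | y < x]].
move=> /countable_injP[f fi].
have cA : countable A.
  pose g x := if pselect (x \in A) is left xA then f (exist _ x xA) else 0%N.
  apply/countable_injP; exists g => x y xA yA; rewrite /g.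
  case: pselect => // {}xA; case: pselect => // {}yA /fi e.
  by have /(congr1 val) := e (in_setT _) (in_setT _).
have AT x : A x.
  elim/(well_founded_ind wo_powerset_wf): x => x IH.
  by apply: sub_countable cA; apply: subset_card_le => y /IH.
move/countable_injP: cA => [g gi].
pose X : set nat := [set n | exists2 Y : set nat, g Y = n & ~ Y n].
have gI (Y : set nat) : g Y = g X -> Y = X.
  by apply: gi; apply/mem_set/AT.
have nX : ~ X (g X).
  by move=> Xg; case: (Xg) => Y /gI -> /(_ Xg).
exact: (nX (ex_intro2 _ _ X erefl nX)).
Qed.

Definition free_filter (p : set_system nat) : Prop :=
  \bigcap_(A in p) A = set0.

Definition principal (p : set_system nat) : Prop :=
  exists n, p = principal_filter n.

(* The image filter f(p) = {B : f^-1(B) \in p} is the library's [f @ p]. *)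
Definition RK_ge (p q : set_system nat) : Prop :=
  exists f : nat -> nat, q `<=` f @ p.

Definition RK_equiv (p q : set_system nat) : Prop := RK_ge p q /\ RK_ge q p.

Definition RK_minimal (u : set_system nat) : Prop :=
  forall f : nat -> nat, principal (f @ u) \/ RK_equiv (f @ u) u.

Definition discrete_filters (p_ : nat -> set_system nat) : Prop :=
  exists U : nat -> set nat, trivIset setT U /\ forall n, p_ n (U n).

Definition contour (p : set_system nat) (p_ : nat -> set_system nat) :
    set_system nat :=
  \bigcup_(P in p) \bigcap_(n in P) p_ n.

Definition J (c : ord) (u : set_system nat) : Prop :=
  UltraFilter u /\
  forall f : nat -> omega1,
    exists2 U, u U & ord_lt (order_type (f @` U)) c.

(* J*_c, where [D] is the class over which d ranges in "not J_d for any d < c".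
   Read literally, D is the class of all ordinals.  But a set of order type
   < omega^(k+1) is a finite union of sets of order type <= omega^k, so a
   J_{omega^(k+1)}-ultrafilter is already a J_{omega^k + 1}-ultrafilter, and the
   literal class J*_{omega^n} is empty for every finite n.  It is not degenerate
   when d ranges, like c, over powers of omega, i.e. over the ordinals for which
   the sets of smaller order type are closed under finite unions. *)
Definition any_ord (d : ord) : Prop := True.

Definition omega_power (d : ord) : Prop := exists b, d = omega_pow b.

Definition J_star (D : ord -> Prop) (c : ord) (u : set_system nat) : Prop :=
  J c u /\ forall d, D d -> ord_lt d c -> ~ J d u.

Definition ordinal_RK_minimal (D : ord -> Prop) (a : ord) (u : set_system nat) :
    Prop :=
  J_star D (omega_pow a) u /\
  forall f : nat -> nat,
    RK_equiv u (f @ u) \/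
    exists2 b, ord_lt b a & J_star D (omega_pow b) (f @ u).

(* Main.v *)
(** Write [I_k] for the ideal of sets of order type < omega^k: [I_0] is {empty}
    and [I_(k+1)] is generated by the sets all of whose proper initial segments
    are in [I_k].  An ultrafilter has rank at most k if every f maps one of its
    sets into [I_k].

    Put u = int_p p_n.  Since p is a P-point, for each f one can trim sets of
    the p_n so that below any point of f(U) only finitely many n contribute;
    hence if almost all p_n have rank k, then u has rank at most k+1.
    Conversely, stacking witnesses for the p_n into consecutive blocks shows
    that the rank goes up.

    If f(u) does not have rank m, then f is injective on a set of almost every
    p_n (otherwise the first part applied to f(u) = int_p f(p_n) bounds the rank
    of f(u)), and no f(p_n) equals f(u).  So the f(p_n) are separated from their
    p-limit, p being selective makes (f(p_n)) discrete on a set of p, and the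
    injective pieces glue to a set of u on which f is injective. *)

Require Import Defs.
From mathcomp Require Import all_boot all_order.
From mathcomp Require Import boolp classical_sets functions cardinality filter.

Set Implicit Arguments.
Unset Strict Implicit.
Unset Printing Implicit Defensive.

Import Order.TTheory.
Local Open Scope classical_set_scope.
Local Open Scope order_scope.

(** * Ideals of sets of order type below omega^k *)

Fixpoint small {d : Order.disp_t} {T : orderType d} (k : nat) (A : set T) :
    Prop :=
  if k is k'.+1 then
    exists2 s : seq (set T), A `<=` [set x | exists2 B, List.In B s & B x]
      & forall B, List.In B s -> forall a, B a -> small k' (B `&` [set x | x < a])
  else A = set0.

Section Small.
Variables (d : Order.disp_t) (T : orderType d).
Implicit Types (A B : set T) (k : nat).

Lemma small_sub k A B : A `<=` B -> small k B -> small k A.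
Proof.
case: k => [|k] /= AB; first by move=> B0; rewrite -subset0 -B0.
by case=> s Bs sk; exists s => // x /AB /Bs.
Qed.

Lemma small0 k : small k (set0 : set T).
Proof. by case: k => //= k; exists [::]. Qed.

Lemma smallU k A B : small k A -> small k B -> small k (A `|` B).
Proof.
case: k => [/= -> ->|k /= [s As ks] [t Bt kt]]; first by rewrite setU0.
exists (s ++ t) => [x|C iC].
  case=> [/As|/Bt] [C iC Cx]; exists C => //; apply: List.in_or_app.
    by left.
  by right.
by case: (List.in_app_or _ _ _ iC) => [/ks|/kt].
Qed.

Lemma small_bigcup k (I : eqType) (s : seq I) (F : I -> set T) :
  (forall i, i \in s -> small k (F i)) -> small k (\bigcup_(i in [set` s]) F i).
Proof.
elim: s => [_|i s IH ks]; first by apply: small_sub (small0 k) => x [].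
apply: (@small_sub _ _ (F i `|` \bigcup_(i in [set` s]) F i)).
  move=> x [j /=]; rewrite inE => /predU1P[-> Fx|js Fx]; first by left.
  by right; exists j.
apply: smallU; first by apply: ks; rewrite inE eqxx.
by apply: IH => j js; apply: ks; rewrite inE js orbT.
Qed.

Lemma small_segments k A :
  (forall a, A a -> small k (A `&` [set x | x < a])) -> small k.+1 A.
Proof.
move=> Ak; exists [:: A] => [x Ax|B [<-|] //]; exists A => //=; by left.
Qed.

Lemma smallS k A : small k A -> small k.+1 A.
Proof.
elim: k A => [A ->|k IH A [s As ks]]; first exact: small0.
by exists s => // B sB a Ba; apply/IH/ks.
Qed.

Lemma small_le j k A : (j <= k)%N -> small j A -> small k A.
Proof.
move=> /subnK <-; elim: (k - j)%N => [|i IH] //= Aj.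
by apply: smallS; exact: IH.
Qed.

(* Only one block can meet a given piece B in a large set: for n < n' the part
   of B in block n lies below any point of B in block n'. *)
Lemma blocks_not_small k (N : set nat) (C : nat -> set T) A :
  (forall n, exists2 i, (n <= i)%N & N i) ->
  (forall n, N n -> C n `<=` A) ->
  (forall n, N n -> ~ small k (C n)) ->
  (forall i j x y, N i -> N j -> (i < j)%N -> C i x -> C j y -> x < y) ->
  ~ small k.+1 A.
Proof.
move=> Ninf CA Cbig Clt [s As ks].
have [M MP] : exists M, forall n, (M <= n)%N -> N n ->
    forall B, List.In B s -> small k (B `&` C n).
  elim: s ks {As} => [_|B s IH ks]; first by exists 0%N.
  have [|M MP] := IH; first by move=> B' sB'; apply: ks; right.
  have [[n0 [Nn0 Bn0]]|nB] := pselect (exists n, N n /\ ~ small k (B `&` C n)).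
    exists (maxn M n0.+1) => n; rewrite geq_max => /andP[Mn n0n] Nn B'.
    case=> [<-|]; last exact: MP.
    apply: contrapT => Bn; apply: Bn0.
    have [a [Ba Ca]] : B `&` C n !=set0.
      by apply/set0P/eqP => B0; apply: Bn; rewrite B0; exact: small0.
    apply: small_sub (ks B (or_introl erefl) a Ba) => x [Bx Cx]; split=> //.
    exact: Clt Nn0 Nn n0n Cx Ca.
  exists M => n Mn Nn B' [<-|]; last exact: MP.
  by apply: contrapT => Bn; apply: nB; exists n.
have [n Mn Nn] := Ninf M.
apply: (Cbig n Nn).
have {}MP B : List.In B s -> small k (B `&` C n) by apply: MP.
have {}As : C n `<=` [set x | exists2 B, List.In B s & B x] by move=> x /(CA n Nn) /As.
elim: s {ks} (C n) As MP => [D DA _|B s IH D DA MP].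
  by apply: small_sub (small0 k) => x /DA[].
apply: (@small_sub _ _ ((B `&` D) `|` (D `\` B))).
  by move=> x Dx; have [Bx|nBx] := pselect (B x); [left|right].
apply: smallU; first by apply: MP; left.
apply: IH => [x [Dx nBx]|B' sB'].
  by have [B' [<-|]] := DA x Dx; [|exists B'].
by apply: small_sub (MP _ (or_intror sB')) => x [B'x [Dx _]].
Qed.

End Small.

Section SmallMorph.
Variables (d d' : Order.disp_t) (T : orderType d) (T' : orderType d').
Implicit Types (A : set T) (k : nat).

(** A strictly increasing map sends the part of a piece below [a] into the part of its image below
    [h a], so a covering list pulls back piece by piece. *)
Lemma small_preimage k (h : T -> T') A :
  {in A &, {homo h : x y / x < y}} -> small k (h @` A) -> small k A.
Proof.
elim: k A => [A _ /= hA0|k IH A hA /= [s As ks]].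
  by rewrite -subset0 => x Ax; have : set0 (h x) by rewrite -hA0; exists x.
exists [seq A `&` h @^-1` B | B <- s].
  move=> x Ax; have [|B sB Bx] := As (h x); first by exists x.
  by exists (A `&` h @^-1` B) => //; apply: List.in_map sB.
move=> C /List.in_map_iff[B [<- sB]] a [Aa Ba]; apply: IH.
  by move=> x y /set_mem[[Ax _] _] /set_mem[[Ay _] _]; apply: hA; exact/mem_set.
apply: small_sub (ks _ sB (h a) Ba) => _ [x [[Ax Bx] xa] <-]; split => //.
by apply: hA => //; exact/mem_set.
Qed.

Lemma small_image k (h : T -> T') A :
  {mono h : x y / x < y} -> small k A -> small k (h @` A).
Proof.
move=> hm; elim: k A => [A -> /=|k IH A /= [s As ks]]; first by rewrite image_set0.
exists [seq h @` B | B <- s].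
  move=> _ [x /As[B sB Bx] <-]; exists (h @` B); last by exists x.
  exact: (List.in_map (fun B : set T => h @` B)).
move=> C /List.in_map_iff[B [<- sB]] _ [a Ba <-].
apply: small_sub (IH _ (ks _ sB a Ba)) => _ [[x Bx <-] /=]; rewrite hm => xa.
by exists x.
Qed.

End SmallMorph.

(** * Cantor normal forms and their initial segments *)

(** Only the top of the descending chain is asked to be in [P]. For a downward closed [P] this says
    that [P] has at least [j] elements, which is how exponents are compared with natural numbers. *)
Fixpoint height_ge {d : Order.disp_t} {T : orderType d} (P : set T) (j : nat) :
    Prop :=
  if j is j'.+1 then exists2 y, P y & height_ge [set z | z < y] j' else True.

Section Cnf.
Variables (d : Order.disp_t) (T : orderType d).
Implicit Types (P : set T) (z c : cnf T).

(** For an initial segment [P] this is the power omega^P inside [cnf T]. *)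
Definition cnf_over P : set (cnf T) :=
  [set z | forall x, x \in (val z : seq T) -> P x].

Definition cnf_behead z : cnf T := insubd z (behead (val z : seq T)).

Lemma val_cnf_behead z : val (cnf_behead z) = behead (val z : seq T) :> seq T.
Proof.
rewrite /cnf_behead val_insubd /=; case: ifP => //.
by case: z => -[|x [|y s]] //= /andP[_ ->].
Qed.

Lemma cnf_head_max z x y s : val z = x :: s :> seq T -> y \in x :: s -> y <= x.
Proof.
move=> zE; have := valP z; rewrite /= zE /= => sz.
rewrite inE => /predU1P[->//|ys].
have ge_trans : transitive (>=%O : rel T) by move=> a b e ab be; exact: le_trans be ab.
by have /allP/(_ y ys) := order_path_min ge_trans sz.
Qed.

(** If [c] has head [a], the forms below it are of two kinds: those with all exponents under [a],
    whose proper initial segments fall to the induction on [j], and those headed by [a], whose tails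
    lie below the tail of [c] and fall to the induction on the list. *)
Lemma small_below_cnf P j c : ~ height_ge P j.+1 -> cnf_over P c ->
  small j [set z | z < c].
Proof.
elim: j P c => [|j IH] P c nP.
  case E : (val c : seq T) => [|a s] Pc.
    rewrite /= -subset0 => z /=; rewrite -lt_val E.
    by case: (val z).
  by case: nP; exists a => //; apply: Pc; rewrite E mem_head.
move E : (val c : seq T) => s.
elim: s c E => [|a s IHs] c E Pc.
  suff -> : [set z | z < c] = set0 by exact: small0.
  rewrite -subset0 => z /=; rewrite -lt_val E.
  by case: (val z).
have Pa : P a by apply: Pc; rewrite E mem_head.
pose L := cnf_over [set x | x < a].
pose K := [set z : cnf T |
  ohead (val z : seq T) = Some a /\ cnf_behead z < cnf_behead c].
apply: (@small_sub _ _ _ _ (L `|` K)).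
  move=> z; rewrite /K /= -[z < c]lt_val E; case zE : (val z : seq T) => [|x t].
    by move=> _; left => x; rewrite zE.
  rewrite ltxi_cons => /andP[xa].
  rewrite -[_ < _ :> cnf T]lt_val !val_cnf_behead E zE /=.
  have [ax|ax] := leP a x; last first.
    move=> _; left=> y; rewrite /= zE => /(cnf_head_max zE) yx; exact: le_lt_trans yx ax.
  move=> ts; right; rewrite /= zE; split => //=.
  by congr Some; apply/eqP; rewrite eq_le xa.
apply: smallU.
  apply: small_segments => a' La'.
  apply: (@small_sub _ _ _ _ [set z | z < a']); first by move=> ? [].
  apply: IH La' => nP'; apply: nP; by exists a.
apply: (@small_preimage _ _ _ _ _ cnf_behead).
  move=> z z' /set_mem[/= za _] /set_mem[/= za' _]; rewrite -!lt_val !val_cnf_behead /=.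
  case: z z' za za' => [[|x t] szt] [[|x' t'] szt'] //= [->] [->].
  by rewrite ltxi_cons lexx.
apply: (@small_sub _ _ _ _ [set z | z < cnf_behead c]); first by move=> _ [z [_ zc] <-].
apply: IHs; first by rewrite val_cnf_behead E.
by move=> x; rewrite val_cnf_behead => /mem_behead; exact: Pc.
Qed.

(** The ordinal omega^y * n + z; the default [z] is not reached when all exponents of [z] lie below
    [y]. *)
Definition cnf_prepend n (y : T) z : cnf T :=
  insubd z (nseq n y ++ (val z : seq T)).

Lemma val_cnf_prepend n y z : cnf_over [set x | x < y] z ->
  val (cnf_prepend n y z) = nseq n y ++ (val z : seq T) :> seq T.
Proof.
move=> zy; rewrite /cnf_prepend val_insubd ifT //.
have := valP z; rewrite /= => sz.
have: path >=%O y (val z : seq T).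
  rewrite /=; move: zy sz; rewrite /cnf_over /=; case: (sval z) => [//|x s] zy /= ->.
  by rewrite ltW //; apply: zy; rewrite mem_head.
elim: n => [|[|n] IH] pz; [exact: sz|exact: pz|].
by move: (IH pz) => /= ->; rewrite lexx.
Qed.

(** If [y] in [P] starts a descending chain of length j + 1, the forms omega^y * n + z, with the
    exponents of z below [y], make omega many stacked blocks, none of them small at level [j] by
    induction. *)
Lemma cnf_over_not_small P j : (forall x y, P x -> y < x -> P y) ->
  height_ge P j -> ~ small j (cnf_over P).
Proof.
elim: j P => [|j IH] P Pdown.
  pose z0 : cnf T := Sub ([::] : seqlexi T) isT.
  by move=> _ P0; have : set0 z0; [rewrite -P0 => x | ].
case=> y Py hy.
pose Y := [set x | x < y].
apply: (@blocks_not_small _ _ _ setT (fun n => cnf_prepend n y @` cnf_over Y)).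
- by move=> n; exists n.
- move=> n _ _ [z Yz <-] x; rewrite (val_cnf_prepend _ Yz) mem_cat.
  case/orP=> [|/Yz/(Pdown _ _ Py)//].
  by rewrite mem_nseq => /andP[_ /eqP->].
- move=> n _ sm; apply: (IH Y) hy _.
    by move=> x x' xy x'x; exact: lt_trans x'x xy.
  apply: small_preimage sm => z z' /set_mem Yz /set_mem Yz'.
  rewrite -!lt_val (val_cnf_prepend _ Yz) (val_cnf_prepend _ Yz').
  elim: n => [//|n IHn] zz'.
  by rewrite /= ltxi_cons lexx; exact: IHn.
- move=> i k _ _ _ _ ik [z Yz <-] [z' Yz' <-].
  rewrite -lt_val (val_cnf_prepend _ Yz) (val_cnf_prepend _ Yz').
  elim: i k ik => [|i IHi] [|k] //= ik; last by rewrite ltxi_cons lexx; exact: IHi.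
  move: Yz; rewrite /cnf_over /=; case: (sval z) => [|x s] Yz //.
  have xy : x < y by apply: Yz; rewrite mem_head.
  by rewrite neqhead_ltxiE ?lt_eqF.
Qed.

End Cnf.

(** * Finite exponents and comparison of well-orders *)

Lemma height_ge_ord m i j : (i <= m)%N -> (j <= i)%N ->
  height_ge [set z : 'I_m | (z < i)%N] j.
Proof.
elim: j i => // j IH i im ji; exists (Ordinal (leq_trans ji im)) => //=.
have jm := leq_trans (ltnW ji) im.
exact: (IH j jm (leqnn j)).
Qed.

Lemma height_ge_bound d (T : orderType d) (h : T -> nat) (P : set T) i j :
  {homo h : x y / x < y >-> (x < y)%N} -> (forall x, P x -> (h x < i)%N) ->
  height_ge P j -> (j <= i)%N.
Proof.
move=> hh; elim: j P i => // j IH P i Pi [y Py hy].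
by apply: leq_trans (Pi _ Py); rewrite ltnS; apply: IH hy => x /hh.
Qed.

Lemma height_ge_exact d (T : orderType d) (P : set T) m :
  ~ height_ge P m -> exists k, [/\ (k < m)%N, height_ge P k & ~ height_ge P k.+1].
Proof.
elim: m => [[]//|m IH] nm.
have [hm|/IH[k [km hk nk]]] := pselect (height_ge P m); first by exists m.
by exists k; split => //; exact: leqW.
Qed.

(* Mostowski collapse of [a] onto an initial segment of [b]. *)
Lemma ord_trichotomy (a b : ord) :
  ord_lt a b \/ exists h : b -> a, {homo h : x y / x < y}.
Proof.
have wf_min (A : set b) : A !=set0 -> exists2 z, A z & forall y, A y -> z <= y.
  case=> x; elim/(well_founded_ind (@ord_wf b)): x => x IH Ax.
  have [[y Ay yx]|nx] := pselect (exists2 y, A y & y < x); first exact: IH y yx Ay.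
  by exists x => // y Ay; rewrite leNgt; apply/negP => yx; apply: nx; exists y.
have [[z0]|nb] := pselect (exists z : b, True); last first.
  by right; exists (fun z => False_rect a (nb (ex_intro _ z I))) => z; case: nb; exists z.
move=> _.
pose least (A : set b) := xget z0 [set z | A z /\ forall y, A y -> z <= y].
have leastP A : A !=set0 -> A (least A) /\ forall y, A y -> least A <= y.
  by move=> /wf_min[z Az zA]; rewrite /least; case: xgetP => [? -> //|/(_ z) []].
pose step (x : a) (rec : forall y : a, y < x -> b) :=
  least [set z | forall y (yx : y < x), z <> rec y yx].
pose g := Fix (@ord_wf a) (fun _ => b : Type) step.
have gE x : g x = least [set z | forall y, y < x -> z <> g y].
  rewrite /g Fix_eq // => y f f' ff'; congr least; apply/funext => z.
  by apply/propext; split=> + t ty => /(_ t ty); rewrite ff'.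
(* [g x] is a junk value once the earlier values exhaust [b]; [free x] says that they do not. *)
pose free x := exists z, forall y, y < x -> z <> g y.
have g_new x y : free x -> y < x -> g x <> g y.
  by move=> /leastP[+ _] => /(_ y); rewrite -gE; apply.
have g_down x z : free x -> z < g x -> exists2 y, y < x & z = g y.
  move=> /leastP[_ +] zx => /(_ z); rewrite -gE leNgt zx => nz.
  apply: contrapT => nex; suff: false by [].
  by apply: nz => y yx zy; apply: nex; exists y.
have g_mono x y : free x -> y < x -> g y < g x.
  move=> fx yx; rewrite ltNge; apply/negP; rewrite le_eqVlt => /predU1P[e|lt].
    exact: g_new fx yx e.
  have fy : free y.
    by case: fx => z zx; exists z => t ty; apply: zx; exact: lt_trans ty yx.
  have [t ty e] := g_down _ _ fy lt; exact: g_new fx (lt_trans ty yx) e.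
(* When the values of [g] on an initial segment exhaust [b], inverting [g] there embeds [b] in
   [a]. *)
have inv (P : set a) : (forall x y, P x -> y < x -> P y) ->
    (forall x, P x -> free x) ->
    (forall z, exists2 x, P x & z = g x) -> exists h : b -> a, {homo h : x y / x < y}.
  move=> Pd Pf Pg; have /choice[h hP] : forall z, exists x, P x /\ z = g x.
    by move=> z; have [x] := Pg z; exists x.
  exists h => z z' zz'; have [Pz ez] := hP z; have [Pz' ez'] := hP z'.
  rewrite ltNge; apply/negP; rewrite le_eqVlt => /predU1P[e|lt].
    by move: zz'; rewrite ez ez' e ltxx.
  have := g_mono _ _ (Pf _ Pz) lt; rewrite -ez -ez' => /lt_trans/(_ zz').
  by rewrite ltxx.
have [[x nx]|allf] := pselect (exists x, ~ free x).
  right; elim/(well_founded_ind (@ord_wf a)): x nx => x IH nx.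
  have [[y yx ny]|minx] := pselect (exists2 y, y < x & ~ free y); first exact: IH ny.
  apply: (inv [set y | y < x]) => [y t yx ty|y yx|z].
  - exact: lt_trans ty yx.
  - by apply: contrapT => ny; apply: minx; exists y.
  - by apply: contrapT => nz; apply: nx; exists z => y yx zy; apply: nz; exists y.
have {}allf x : free x by apply: contrapT => nx; apply: allf; exists x.
have [surj|nsurj] := pselect (forall z, exists x, z = g x).
  right; apply: (inv setT) => // z; by have [x ->] := surj z; exists x.
left; have [c cg cmin] : exists2 c, ~ range g c & forall y, ~ range g y -> c <= y.
  apply: wf_min; apply: contrapT => ne; apply: nsurj => z; apply: contrapT => nz.
  by apply: ne; exists z => -[x _ gx]; apply: nz; exists x.
exists c, g; split.
  move=> x y; apply/idP/idP => [lt|]; last exact: g_mono.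
  rewrite ltNge; apply/negP; rewrite le_eqVlt => /predU1P[e|yx].
    by rewrite e ltxx in lt.
  by have := lt_trans lt (g_mono _ _ (allf _) yx); rewrite ltxx.
apply/seteqP; split=> [_ [x _ <-]|z] /=; last first.
  by move=> zc; apply: contrapT => nz; have := cmin z nz; rewrite leNgt zc.
rewrite ltNge; apply/negP; rewrite le_eqVlt => /predU1P[e|cx].
  by apply: cg; exists x.
by have [y _ e] := g_down _ _ (allf x) cx; apply: cg; exists y.
Qed.

Lemma small_order_type (W : ord) (A : set W) k :
  small k [set: order_type A] <-> small k A.
Proof.
split=> [/(small_image (h := val))|Ak].
  move=> /(_ (fun x y => lt_val _ _)); apply: small_sub => x Ax.
  by exists (exist _ x (mem_set Ax)).
apply: (@small_preimage _ _ _ _ _ val); first by move=> x y _ _; rewrite lt_val.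
by apply: small_sub Ak => _ [x _ <-]; exact/set_mem/(valP x).
Qed.

(** [a] embeds in the points below some normal form. Together with [ord_lt_small], this equates
    [small k] with order type below [omega_pow b] for every [b] of exactly [k] elements. *)
Lemma small_ord_lt (a b : ord) k : ord_lt a (omega_pow b) ->
  ~ height_ge [set: b] k.+1 -> small k [set: a].
Proof.
case=> [c [h [hm hr]]] nb; apply: (@small_preimage _ _ _ _ _ h).
  by move=> x y _ _; rewrite hm.
by rewrite hr; apply: (small_below_cnf nb) => x.
Qed.

(** Otherwise [omega_pow b] embeds in [a] by trichotomy and would be small as well. *)
Lemma ord_lt_small (a b : ord) k : small k [set: a] -> height_ge [set: b] k ->
  ord_lt a (omega_pow b).
Proof.
move=> ak hb; have [//|[h hm]] := ord_trichotomy a (omega_pow b).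
case: (@cnf_over_not_small _ b setT k) => //.
apply: (@small_preimage _ _ _ _ _ h); first by move=> x y _ _; exact: hm.
exact: small_sub ak.
Qed.

Lemma omega_pow_small (b : ord) k : ~ height_ge [set: b] k.+1 ->
  small k.+1 [set: omega_pow b].
Proof.
move=> nb; apply: small_segments => c _.
by apply: small_sub (small_below_cnf nb (c := c) _) => [z []|x].
Qed.

Lemma omega_pow_not_small (b : ord) k : height_ge [set: b] k ->
  ~ small k [set: omega_pow b].
Proof.
move=> hb; move/(small_sub (B := setT) (A := cnf_over setT)).
by move=> /(_ (fun _ _ => I)); exact: cnf_over_not_small.
Qed.

Lemma nat_ord_height k : height_ge [set: nat_ord k] k.
Proof.
rewrite (_ : setT = [set z : 'I_k | (z < k)%N]); first exact: height_ge_ord.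
by apply/seteqP; split => x //= _; exact: ltn_ord.
Qed.

Lemma nat_ord_height_bound k : ~ height_ge [set: nat_ord k] k.+1.
Proof.
move=> /(@height_ge_bound _ _ (@nat_of_ord k) _ k); rewrite ltnn => H.
by have : false by apply: H => x //= _; exact: ltn_ord.
Qed.

Lemma ord_lt_nat_ord (b : ord) m : ord_lt b (nat_ord m) ->
  exists k, [/\ (k < m)%N, height_ge [set: b] k & ~ height_ge [set: b] k.+1].
Proof.
case=> [c [h [hm hr]]]; have : ~ height_ge [set: b] m.
  move=> /(@height_ge_bound _ _ (fun x => nat_of_ord (h x)) _ c) H.
  suff : (m <= c)%N by rewrite leqNgt ltn_ord.
  apply: H => [x y|x _]; first by rewrite -hm.
  by have := imageT h x; rewrite hr.
by move=> /height_ge_exact.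
Qed.

Lemma nat_ord_lt k m : (k < m)%N -> ord_lt (nat_ord k) (nat_ord m).
Proof.
move=> km; have [//|[h hm]] := ord_trichotomy (nat_ord k) (nat_ord m).
have /(@height_ge_bound _ _ (fun x => nat_of_ord (h x)) _ k) H := nat_ord_height m.
suff : (m <= k)%N by rewrite leqNgt km.
by apply: H => [x y /hm|x _]; [|exact: ltn_ord].
Qed.

(** * Ranks of ultrafilters *)

Definition small_images (k : nat) (u : set_system nat) : Prop :=
  forall f : nat -> omega1, exists2 U, u U & small k (f @` U).

Lemma J_omega_powP (b : ord) k u : UltraFilter u ->
  height_ge [set: b] k -> ~ height_ge [set: b] k.+1 ->
  J (omega_pow b) u <-> small_images k u.
Proof.
move=> uu hb nb; split=> [[_ Ju] f|Su].
  by have [U uU] := Ju f; exists U => //; apply/small_order_type; exact: small_ord_lt nb.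
split=> // f; have [U uU fU] := Su f; exists U => //.
by apply: ord_lt_small hb; apply/small_order_type.
Qed.

(** A power [omega_pow b] below omega^k has a [b] of exactly j < k elements, because height [k]
    would keep it out of the ideal. So the classes to be excluded reduce to the ranks j < k. *)
Lemma J_star_omega_powerP k u : UltraFilter u ->
  J_star omega_power (omega_pow (nat_ord k)) u <->
  small_images k u /\ forall j, (j < k)%N -> ~ small_images j u.
Proof.
move=> uu; have hk := nat_ord_height; have nk := nat_ord_height_bound.
have JP j := J_omega_powP uu (hk j) (@nk j).
split=> [[/JP Ju nJ]|[/JP Ju nJ]].
  split=> // j jk /JP; apply: nJ; first by exists (nat_ord j).
  by apply: ord_lt_small (hk k); apply: (small_le jk); exact: omega_pow_small (@nk j).
split=> // _ [b ->] bk Jb.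
have /height_ge_exact[c [ck hc nc]] : ~ height_ge [set: b] k.
  by move/omega_pow_not_small; apply; exact: small_ord_lt bk (@nk k).
by apply: (nJ c ck); exact: (J_omega_powP uu hc nc).1.
Qed.

Lemma small_images0 u : ProperFilter u -> ~ small_images 0 u.
Proof.
move=> uu S0.
have [[x _]|no] := pselect (exists x : omega1, True).
  have [U uU /= U0] := S0 (fun=> x).
  have [n Un] := filter_ex uU.
  by have : set0 x by rewrite -U0; exists n.
apply: omega1_uncountable; rewrite (_ : setT = set0) //.
by rewrite -subset0 => x _; apply: no; exists x.
Qed.

Lemma ultra_list_cover T (u : set_system T) (A : set T) (s : seq (set T)) :
  UltraFilter u -> u A -> A `<=` [set x | exists2 B, List.In B s & B x] ->
  exists2 B, List.In B s & u (A `&` B).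
Proof.
move=> uu; elim: s A => [|B s IH] A uA As.
  have : u set0 by apply: filterS uA => x /As[].
  by move/filter_ex => [].
have [uB|uB] := in_ultra_setVsetC B uu.
  by exists B; [left|exact: filterI].
have [|C sC uC] := IH _ (filterI uA uB).
  by move=> x [/As[C [<-|sC] Cx] nBx] //; exists C.
by exists C; [right|apply: filterS uC => x [[]]].
Qed.

(* A set of order type < omega^(k+1) is a finite union of sets all of whose
   proper initial segments have order type < omega^k; an ultrafilter contains
   one of the pieces, hence the class is empty already at omega^k + 1. *)
Lemma J_star_any_omega_power k u : ~ J_star any_ord (omega_pow (nat_ord k)) u.
Proof.
move=> [Ju nJ]; have uu := Ju.1.
have /(J_omega_powP uu (@nat_ord_height k) (@nat_ord_height_bound k)) Su := Ju.
case: k Ju nJ Su => [|k] Ju nJ Su; first exact: small_images0 Su.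
pose W := omega_pow (nat_ord k.+1).
(* The largest exponent available is [k], so [c0] is omega^k and [D] has order type omega^k + 1. *)
pose c0 : W := Sub ([:: ord_max : nat_ord k.+1] : seqlexi (nat_ord k.+1)) isT.
pose D := [set x : W | x <= c0].
apply: (nJ (order_type D)) => //.
  apply: ord_lt_small (@nat_ord_height k.+1); apply/small_order_type.
  apply: (@small_sub _ _ _ _ ([set x | x < c0] `|` [set c0])).
    by move=> x; rewrite /D /= le_eqVlt => /predU1P[->|]; [right|left].
  apply: smallU.
    by apply: (@small_below_cnf _ _ setT); [exact: nat_ord_height_bound|].
  apply: small_segments => _ ->; apply: small_sub (small0 _ k) => x /= [-> ].
  by rewrite ltxx.
split=> // f; have [U uU [s Us sk]] := Su f.
have [|B' /List.in_map_iff[B [<- sB]] uUB] :=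
    @ultra_list_cover _ u U [seq f @^-1` B | B <- s] uu uU.
  move=> x Ux; have [|B sB Bx] := Us (f x); first by exists x.
  exists (f @^-1` B) => //.
  exact: (List.in_map (fun B : set omega1 => f @^-1` B)).
  exists (U `&` f @^-1` B) => //.
  set A := f @` _.
  have [//|[h hm]] := ord_trichotomy (order_type A) (order_type D).
  (* If [D] embeds in the image of the piece, the image of its top [c1] cuts off a proper initial
     segment of [B] that contains a copy of omega^k, against smallness at level [k]. *)
  pose c1 : order_type D := exist _ c0 (mem_set (lexx c0 : D c0)).
  case: (@cnf_over_not_small _ (nat_ord k.+1) [set x | x < ord_max] k) => //.
  - by move=> x y /= + yx; exact: lt_trans.
  - exact: (@height_ge_ord k.+1 k k).
  apply: (@small_sub _ _ _ _ (val @` [set z : order_type D | z < c1])).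
    move=> z zk; have zc : z < c0.
      rewrite -lt_val; move: zk; rewrite /cnf_over /=; case: (sval z) => [|x t] //= zk.
      have xk : x < ord_max := zk x (mem_head x t).
      by rewrite neqhead_ltxiE // lt_eqF.
    by exists (exist _ z (mem_set (ltW zc : D z))).
  apply: small_image; first by move=> x y; exact: lt_val.
  apply: (@small_preimage _ _ _ _ _ (val \o h)).
    by move=> x y _ _ /hm.
  have /set_mem[j [_ Bj] fj] := valP (h c1).
  have Bc : B (val (h c1)) by rewrite -fj.
  apply: small_sub (sk _ sB _ Bc) => _ [x xc <-]; split; last exact: hm xc.
  by have /set_mem[i [_ Bi] fi] := valP (h x); rewrite /= -fi.
Qed.

(** * General facts on ultrafilters *)

Lemma ultra_setVsetC T (F : set_system T) : ProperFilter F ->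
  (forall A, F A \/ F (~` A)) -> UltraFilter F.
Proof.
move=> FF FA; split=> // G GG FG; apply/seteqP; split=> // A GA.
have [//|/FG GnA] := FA A.
by have /filter_ex[] : G set0 by rewrite -(setICr A); exact: filterI.
Qed.

Lemma ultra_notin T (F : set_system T) A : UltraFilter F -> ~ F A -> F (~` A).
Proof. by move=> FF nA; have [] := in_ultra_setVsetC A FF. Qed.

Lemma ultra_separate T (F G : set_system T) : UltraFilter F -> UltraFilter G ->
  F <> G -> exists2 A, F A & ~ G A.
Proof.
move=> FF GG FG; apply: contrapT => nA; apply: FG; apply/esym/max_filter => A FA.
by apply: contrapT => nGA; apply: nA; exists A.
Qed.

Lemma filter_forall_lt T (F : set_system T) (B : nat -> set T) n : Filter F ->
  (forall i, (i < n)%N -> F (B i)) -> F [set x | forall i, (i < n)%N -> B i x].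
Proof.
move=> FF; elim: n => [|n IH] FB; first by apply: filterS filterT => x.
have {}IH := IH (fun i lt => FB i (ltnW lt)).
apply: filterS (filterI IH (FB n (ltnSn n))) => x [Bx Bnx] i.
by rewrite ltnS leq_eqVlt => /predU1P[->|/Bx].
Qed.

Lemma fmap_ultra T S (f : T -> S) (F : set_system T) : UltraFilter F ->
  UltraFilter (f @ F).
Proof.
move=> FF; apply: ultra_setVsetC => A.
exact: (in_ultra_setVsetC (f @^-1` A) FF).
Qed.

Lemma free_above (p : set_system nat) n : UltraFilter p -> free_filter p ->
  p [set x | (n <= x)%N].
Proof.
move=> pp pf.
apply: (@filterS _ _ _ [set x | forall i, (i < n)%N -> x <> i]).
  by move=> x xn; rewrite /= leqNgt; apply/negP => /xn.
apply: (@filter_forall_lt _ _ (fun i => [set x | x <> i])) => i _.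
apply: ultra_notin => pi; suff : (set0 : set nat) i by [].
rewrite -pf => A pA; have [x [Ax <-]] := filter_ex (filterI pA pi).
exact: Ax.
Qed.

(** * Maps fixing an ultrafilter, selectivity and P-points *)

Section FixedPoint.
Variable u : set_system nat.
Hypotheses (uu : UltraFilter u) (uf : free_filter u).

(* The N-th colour of x is the parity of the number of points among
   x, h x, ..., h^(N-1) x that are active at stage N; the colouring is the limit
   of these along u. *)
Lemma alternating_coloring (h : nat -> nat) (A : set nat)
    (active : nat -> nat -> bool) :
  (forall x, A x -> u [set N | active N x && ~~ active N (iter N h x)]) ->
  exists c : set nat, forall x, A x -> c (h x) <-> ~ c x.
Proof.
move=> uA; pose col N x := odd (\sum_(a < N) active N (iter a h x)).
have colh N x : active N x && ~~ active N (iter N h x) -> col N (h x) = ~~ col N x.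
  move=> /andP[ax /negbTE nax]; rewrite /col.
  (* The sum over N + 1 points of the orbit is split at either end: dropping the active first point
     and adding the inactive last one changes the parity. *)
  have := @big_ord_recl _ 0%N addn N (fun a : 'I_N.+1 => active N (iter a h x) : nat).
  rewrite big_ord_recr /= nax addn0 ax => ->; rewrite add1n /= negbK.
  by congr odd; apply: eq_bigr => a _; rewrite -iterSr.
exists [set x | u [set N | col N x]] => x /uA ux /=; split.
  move=> uh ux'; have [N [[/colh + ]]] := filter_ex (filterI (filterI ux uh) ux').
  by move=> /= -> /negP.
move/ultra_notin => un.
by apply: filterS (filterI ux un) => N [/colh /= -> /negP].
Qed.

(** One of [c] and its complement is in [u], and so is its preimage under [h]; but [h] swaps the two
    on [A]. *)
Lemma alternating_not_large (h : nat -> nat) (A c : set nat) :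
  u `<=` h @ u -> (forall x, A x -> c (h x) <-> ~ c x) -> ~ u A.
Proof.
move=> uh cA uA; have uhB B : u B -> u (h @^-1` B) by move/uh.
have [uc|uc] := in_ultra_setVsetC c uu.
  have [x [[/cA[hc _] cx] chx]] := filter_ex (filterI (filterI uA uc) (uhB _ uc)).
  exact: hc.
have [x [[/cA[_ hc] cx] chx]] := filter_ex (filterI (filterI uA uc) (uhB _ uc)).
by apply/chx/hc.
Qed.

(** A point that is not fixed is lowered or raised. In each case [h'] agrees with [h] on the points
    concerned and moves every point that way (0 stays at 0 when lowering), so orbits reach 0 or pass
    every bound. Being active means [0 < x] when lowering and [x < N] when raising; the resulting
    colouring is swapped by [h] and rules out both cases. *)
Lemma ultra_fixed_point (h : nat -> nat) : u `<=` h @ u -> u [set x | h x = x].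
Proof.
move=> uh; apply: contrapT => /ultra_notin nfix.
have [ult|nlt] := pselect (u [set x | (h x < x)%N]).
  pose h' x := minn (h x) x.-1.
  have h'N N x : (iter N h' x <= x - N)%N.
    elim: N => [|N IH]; first by rewrite subn0.
    rewrite iterS subnS; apply: leq_trans (geq_minr _ _) _.
    by rewrite -!subn1 leq_sub2r.
  have [|c cP] := @alternating_coloring h' [set x | (h x < x)%N] (fun N x => (0 < x)%N).
    move=> x /= hx; apply: filterS (free_above x uu uf) => N /= xN.
    rewrite (leq_ltn_trans (leq0n _) hx) -leqNgt.
    by apply: leq_trans (h'N N x) _; rewrite leqn0 subn_eq0.
  apply: (alternating_not_large uh (c := c)) ult => x hx.
  rewrite -(cP x hx) /h' (minn_idPl _) //.
  by move: hx => /=; case: x.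
pose h' x := maxn (h x) x.+1.
have h'N N x : (x + N <= iter N h' x)%N.
  elim: N => [|N IH]; first by rewrite addn0.
  by rewrite iterS addnS; apply: leq_trans (leq_maxr _ _); rewrite ltnS.
have [|c cP] := @alternating_coloring h' [set x | (x < h x)%N] (fun N x => (x < N)%N).
  move=> x /= hx; apply: filterS (free_above x.+1 uu uf) => N /= ->.
  by rewrite -leqNgt; apply: leq_trans (h'N N x); exact: leq_addl.
apply: (@alternating_not_large h [set x | (x < h x)%N] c) => //.
  by move=> x hx; rewrite -(cP x hx) /h' (maxn_idPl _).
apply: filterS (filterI nfix (ultra_notin uu nlt)) => x [/= /eqP hx /negP].
by rewrite -leqNgt ltn_neqAle eq_sym hx.
Qed.

(** A witness [g] for the hypothesis makes [g \o f] fix [u], so this composite is the identity on a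
    set of [u]. *)
Lemma RK_ge_fmap_inj (f : nat -> nat) : RK_ge (f @ u) u ->
  exists2 A, u A & forall x y, A x -> A y -> f x = f y -> x = y.
Proof.
case=> g ug; exists [set x | g (f x) = x]; first exact: (@ultra_fixed_point (g \o f)).
by move=> x y /= {2}<- {2}<- ->.
Qed.

Lemma inj_RK_equiv (f : nat -> nat) A : u A ->
  (forall x y, A x -> A y -> f x = f y -> x = y) -> RK_equiv u (f @ u).
Proof.
move=> uA finj; split; first by exists f.
pose g y := xget 0%N [set x | A x /\ f x = y].
have gK x : A x -> g (f x) = x.
  move=> Ax; rewrite /g; case: xgetP => [y -> [Ay fyx]|/(_ x)[]//].
  exact: finj.
exists g => B uB; apply: (@filterS _ u _ (A `&` B)); last exact: filterI.
by move=> x [Ax Bx]; rewrite /= gK.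
Qed.

Lemma RK_minimal_selective (f : nat -> nat) : RK_minimal u ->
  (exists c, u [set x | f x = c]) \/
  exists2 A, u A & forall x y, A x -> A y -> f x = f y -> x = y.
Proof.
move=> /(_ f)[[n un]|[/RK_ge_fmap_inj]]; last by right.
by left; exists n; change ((f @ u) [set n]); rewrite un; exact/principal_filterP.
Qed.

(** Where it exists, let [g n] be the least [i] with [n] outside [A i]. It is constant on no set of
    [u], as every [A c] is in [u]; so it is injective on some [Q] in [u], and only finitely many [n]
    there have [g n] at most [i]. *)
Lemma RK_minimal_Ppoint (A : nat -> set nat) : RK_minimal u ->
  (forall i, u (A i)) ->
  exists2 P, u P & forall i, exists M, forall n, (M <= n)%N -> P n -> A i n.
Proof.
move=> um uA; pose C := [set n | exists i, ~ A i n].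
have [uC|uC] := in_ultra_setVsetC C uu; last first.
  exists (~` C) => // i; exists 0%N => n _ nC.
  by apply: contrapT => nA; apply: nC; exists i.
pose g n := xget 0%N [set i | ~ A i n /\ forall j, (j < i)%N -> A j n].
have gP n : C n -> ~ A (g n) n /\ forall j, (j < g n)%N -> A j n.
  move=> [i0 nA]; rewrite /g; case: xgetP => [i -> //|ni].
  exfalso; elim/ltn_ind: i0 nA => i IH nA; case: (ni i); split => // j ji.
  by apply: contrapT => nAj; exact: IH ji nAj.
have [[c uc]|[Q uQ Qinj]] := RK_minimal_selective g um.
  have [n [[/gP[nA _] gn] An]] := filter_ex (filterI (filterI uC uc) (uA c)).
  by case: nA; rewrite gn.
exists (Q `&` C); first exact: filterI.
move=> i.
suff [M MP] : exists M, forall n, (M <= n)%N -> (Q `&` C) n -> (i < g n)%N.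
  exists M => n Mn QCn; have [_] := gP n QCn.2; apply; exact: MP.
have step j : exists M, forall n, (M <= n)%N -> (Q `&` C) n -> g n <> j.
  have [[n0 [Qn0 gn0]]|nn] := pselect (exists n, Q n /\ g n = j).
    exists n0.+1 => n n0n [Qn _] gn.
    by move: n0n; rewrite (Qinj n0 n) ?ltnn // gn.
  by exists 0%N => n _ [Qn _] gn; apply: nn; exists n.
elim: i => [|i [M MP]].
  by have [M MP] := step 0%N; exists M => n Mn QC; rewrite lt0n; apply/eqP; exact: MP.
have [M' MP'] := step i.+1; exists (maxn M M') => n; rewrite geq_max => /andP[Mn M'n] QC.
by rewrite ltn_neqAle eq_sym MP // andbT; apply/eqP; exact: MP'.
Qed.

End FixedPoint.

(** * Images in arbitrary well-orders *)

Lemma small_set1 d (T : orderType d) k (t : T) : small k.+1 [set t].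
Proof.
apply: small_segments => _ ->; apply: small_sub (small0 _ k) => x [-> /=].
by rewrite ltxx.
Qed.

Lemma small_images_fmap k (g : nat -> nat) u : Filter u ->
  small_images k u -> small_images k (g @ u).
Proof.
move=> uu Su f; have [U uU fU] := Su (f \o g).
exists (g @` U); first by apply: (@filterS _ u _ U) => // x Ux; exists x.
by apply: small_sub fU => _ [_ [x Ux <-] <-]; exists x.
Qed.

(** The lexicographic product consists of omega many consecutive copies of [W], the target in which
    one witness per block is stacked. *)
Lemma lexi_nat_ord_wf (W : ord) :
  well_founded (fun x y : nat *lexi[Order.Disp tt tt] W => x < y).
Proof.
move=> [n t]; elim/ltn_ind: n t => n IHn t.
elim/(well_founded_ind (@ord_wf W)): t => t IHt.
constructor => -[n' t']; rewrite ltxi_pair /= => /andP[].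
rewrite !leEnat leq_eqVlt => /predU1P[->|lt _]; last exact: IHn.
by rewrite leqnn; exact: IHt.
Qed.

Lemma ltxi_fst (W : ord) i j (s t : W) : (i < j)%N ->
  ((i, s) : nat *lexi[Order.Disp tt tt] W) < (j, t).
Proof. by move=> ij; rewrite ltxi_pair /= !leEnat (ltnW ij) leqNgt ij. Qed.

(* A function on nat has countable range, so a well-order can be replaced by
   omega_1 without changing the induced preorder on nat. *)
Lemma small_images_ord (W : ord) (f : nat -> W) k u : small_images k u ->
  exists2 U, u U & small k (f @` U).
Proof.
move=> Su; pose A := range f.
have fA n : f n \in A by apply/mem_set; exists n.
have [[c [h [hm _]]]|[h hm]] := ord_trichotomy (order_type A) omega1; last first.
  case: omega1_uncountable; have /choice[g gP] : forall x, exists n, f n = val (h x).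
    by move=> x; have /set_mem[n _ fn] := valP (h x); exists n.
  apply/countable_injP; exists g => x y _ _ gxy.
  have hxy : h x = h y by apply: val_inj; rewrite -!gP gxy.
  by case: (ltgtP x y) => // /hm; rewrite hxy ltxx.
have [U uU hU] := Su (fun n => h (exist _ (f n) (fA n))); exists U => //.
pose B := [set z : order_type A | exists2 n, U n & z = exist _ (f n) (fA n)].
apply: (@small_sub _ _ _ _ (val @` B)).
  by move=> _ [n Un <-]; exists (exist _ (f n) (fA n)) => //; exists n.
apply: small_image; first by move=> x y; exact: lt_val.
apply: (@small_preimage _ _ _ _ _ h); first by move=> x y _ _; rewrite hm.
by apply: small_sub hU => _ [_ [n Un ->] <-]; exists n.
Qed.

(** * The rank of a contour *)

Section Contour.
Variables (p : set_system nat) (p_ : nat -> set_system nat).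
Hypotheses (pp : UltraFilter p) (pn : forall n, UltraFilter (p_ n)).

Lemma contourP B : contour p p_ B <-> p [set n | p_ n B].
Proof.
split=> [[P pP PB]|pB]; first by apply: filterS pP => n /PB.
by exists [set n | p_ n B].
Qed.

Lemma contour_ultra : UltraFilter (contour p p_).
Proof.
apply: ultra_setVsetC => [|A]; last first.
  have [pA|pA] := in_ultra_setVsetC [set n | p_ n A] pp.
    by left; apply/contourP.
  by right; apply/contourP; apply: filterS pA => n /ultra_notin; exact.
split; first by move=> /contourP/filter_ex[n] /filter_ex[].
split=> [|A B /contourP pA /contourP pB|A B AB /contourP pA]; apply/contourP.
- by apply: filterS filterT => n _; exact: filterT.
- by apply: filterS (filterI pA pB) => n [/= nA nB]; exact: filterI.
- by apply: filterS pA => n; exact: filterS.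
Qed.

Hypotheses (pf : free_filter p) (pmin : RK_minimal p).

Lemma contour_small_images k : p [set n | small_images k (p_ n)] ->
  small_images k.+1 (contour p p_).
Proof.
move=> pk f; set u := contour p p_; have uu : UltraFilter u := contour_ultra.
pose above i := [set x | f i < f x].
pose G := [set i | u (above i)].
have [uG|uG] := in_ultra_setVsetC G uu; last first.
  (* On a set of [u] the values are at least the least value [f j0] outside [G], and at most [f j0]
     since [above j0] is not in [u]; so [f] is constant there. *)
  have [j0 nGj0 jmin] : exists2 j0, ~ G j0 & forall j, ~ G j -> f j0 <= f j.
    have [j nGj] := filter_ex uG.
    have [t] : exists t, f j = t by exists (f j).
    elim/(well_founded_ind (@ord_wf omega1)): t j nGj => t IH j nGj jt.
    have [[i [nGi it]]|ni] := pselect (exists i, ~ G i /\ f i < t).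
      exact: (IH (f i) it i).
    exists j => // i nGi; rewrite leNgt jt; apply/negP => it; apply: ni.
    by exists i.
  exists (~` G `&` ~` above j0); first exact: filterI uG (ultra_notin uu nGj0).
  apply: small_sub (small_set1 _ (f j0)) => _ [x [/jmin j0x /negP xj0] <-].
  by apply/eqP; rewrite eq_le j0x leNgt andbT.
pose A i := [set n | G i -> p_ n (above i)].
have pA i : p (A i).
  have [/contourP Gi|nGi] := pselect (G i); first by apply: filterS Gi => n pni _.
  by apply: filterS filterT => n _ /nGi.
have [P pP PA] := RK_minimal_Ppoint pp pf pmin pA.
have /choice[V VP] : forall n, exists V, small k (f @` V) /\
    (small_images k (p_ n) -> p_ n V).
  move=> n; have [S|nS] := pselect (small_images k (p_ n)).
    by have [V pV fV] := S f; exists V.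
  by exists set0; split => //; rewrite image_set0; exact: small0.
(* The trimming: a point contributed by [n] lies above every [f i] with i < n that [p_ n] allows.
   Below [f i] only indices under [maxn M i.+1] then remain. *)
pose V' n := V n `&` [set x | forall i, (i < n)%N -> p_ n (above i) -> above i x].
exists (G `&` [set x | exists2 n, P n & V' n x]).
  apply: filterI => //; apply/contourP.
  apply: filterS (filterI pP pk) => n [Pn Sn].
  apply: (@filterS _ _ _ (V' n)); first by move=> x Vx; exists n.
  apply: filterI; first exact: (VP n).2.
  apply: (@filter_forall_lt _ _ (fun i x => p_ n (above i) -> above i x)) => i _.
  have [pi|npi] := pselect (p_ n (above i)); first by apply: filterS pi => x.
  by apply: filterS filterT => x _ /npi.
apply: small_segments => _ [i [Gi _] <-].
have [M MP] := PA i.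
apply: (@small_sub _ _ _ _
    (\bigcup_(n in [set` iota 0 (maxn M i.+1)]) (f @` V n))); last first.
  by apply: small_bigcup => n _; exact: (VP n).1.
move=> _ [[x [_ [n Pn [Vx abx]]] <-] /= xi]; exists n => /=; last by exists x.
rewrite mem_iota add0n /= ltnNge geq_max; apply/negP => /andP[Mn ni].
by have := lt_trans (abx i ni (MP n Mn Pn Gi)) xi; rewrite ltxx.
Qed.

(** A point x of [U n] is sent to the pair of n and [F n x], where [F n] witnesses that [p_ n] does
    not have rank [k]. The image of a set of the contour then contains infinitely many stacked
    blocks outside the ideal. *)
Lemma contour_not_small_images k : discrete_filters p_ ->
  (forall n, ~ small_images k (p_ n)) -> ~ small_images k.+1 (contour p p_).
Proof.
move=> [U [Udisj pU]] nS Su.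
have /choice[F FP] : forall n, exists f : nat -> omega1,
    forall V, p_ n V -> ~ small k (f @` V).
  move=> n; apply: contrapT => nf; apply: (nS n) => f; apply: contrapT => nV.
  by apply: nf; exists f => V pV fV; apply: nV; exists V.
pose W := Ord (@lexi_nat_ord_wf omega1).
(* The default 0 is harmless: only points of the sets [U n] enter the blocks. *)
pose idx x := xget 0%N [set n | U n x].
have idxP n x : U n x -> idx x = n.
  move=> Ux; rewrite /idx; case: xgetP => [i _ Uix|/(_ n)//].
  by apply: (Udisj i n) => //; exists x.
have [V uV wV] := @small_images_ord W (fun x => (idx x, F (idx x) x)) _ _ Su.
move/contourP: uV => pV.
apply: (@blocks_not_small _ _ k [set n | p_ n V]
    (fun n => (fun x => (n, F n x) : W) @` (V `&` U n)) _ _ _ _ _ wV).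
- move=> n; have [i [ni Vi]] := filter_ex (filterI (free_above n pp pf) pV).
  by exists i.
- by move=> n _ _ [x [Vx Ux] <-]; exists x => //; rewrite (idxP n).
- move=> n /= Vn nk; apply: (FP n (V `&` U n)); first exact: filterI.
  apply: (@small_preimage _ _ _ W _ (fun t => (n, t) : W)).
    by move=> s t _ _ st; rewrite /= ltxi_pair /= lexx.
  by apply: small_sub nk => _ [_ [x Vx <-] <-]; exists x.
- move=> i j _ _ _ _ ij [x _ <-] [y _ <-].
  exact: ltxi_fst.
Qed.

End Contour.

(** * Separating the image ultrafilters and gluing injective pieces *)

(** A set of [q n] outside the limit belongs to [q k] for only finitely many [k] in a suitable set
    of [p]; once the [q k] are distinct, these few are separated from [q n] one by one. *)
Lemma disjoint_refinement (p : set_system nat) (q : nat -> set_system nat) :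
  UltraFilter p -> free_filter p -> RK_minimal p ->
  (forall n, UltraFilter (q n)) -> UltraFilter (contour p q) ->
  (forall n, q n <> contour p q) ->
  exists R E, [/\ p R, forall n, R n -> q n (E n) &
    forall i j x, R i -> R j -> E i x -> E j x -> i = j].
Proof.
move=> pp pf pmin qu vu qv.
have /choice[B BP] : forall n, exists B, q n B /\ ~ contour p q B.
  by move=> n; have [B qB vB] := ultra_separate (qu n) vu (@qv n); exists B.
pose A i := [set k | ~ q k (B i)].
have pA i : p (A i) by apply: ultra_notin => pB; apply: (BP i).2; apply/contourP.
have [P pP PA] := RK_minimal_Ppoint pp pf pmin pA.
(* [c] picks one index for each value of [q]. If it were constantly [e] on a set of [p], some [q k]
   equal to [q e] would lack [B e]; so it is injective on a set of [p], where the [q k] are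
   distinct. *)
pose c k := xget 0%N [set j | q j = q k].
have qc k : q (c k) = q k by rewrite /c; case: xgetP => [j _ //|/(_ k)[]].
have [[e ce]|[Q pQ Qinj]] := RK_minimal_selective pp pf c pmin.
  have [k [/= ck]] := filter_ex (filterI ce (pA e)).
  by rewrite /A /= -qc ck; have [] := BP e.
pose R := P `&` Q.
have qinj i j : R i -> R j -> q i = q j -> i = j.
  by move=> [_ Qi] [_ Qj] qij; apply: Qinj => //; rewrite /c qij.
have /choice[B' B'P] : forall n, exists B', R n ->
    q n B' /\ forall k, R k -> k <> n -> ~ q k B'.
  move=> n; have [Rn|nRn] := pselect (R n); last by exists set0.
  have [M MP] := PA n.
  have /choice[D DP] : forall k, exists D, q n D /\ (R k -> k <> n -> ~ q k D).
    move=> k; have [e|ne] := pselect (q n = q k).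
      by exists setT; split; [exact: filterT|move=> Rk; case; apply: qinj].
    by have [D] := ultra_separate (qu n) (qu k) ne; exists D.
  exists (B n `&` [set x | forall k, (k < M)%N -> D k x]) => _; split.
    by apply: filterI; [exact: (BP n).1|apply: filter_forall_lt => k _; exact: (DP k).1].
  move=> k Rk kn; case: (ltnP k M) => [kM|Mk] qB.
    by apply: ((DP k).2 Rk kn); apply: filterS qB => x [_]; apply.
  by apply: (MP k Mk Rk.1); apply: filterS qB => x [].
(* Removing the earlier [B' j] keeps the set in [q n], which contains none of them. *)
pose E n := B' n `&` [set x | forall j, (j < n)%N -> R j -> ~ B' j x].
exists R, E; split; first exact: filterI.
  move=> n Rn; apply: filterI; first by have [] := B'P n Rn.
  apply: (@filter_forall_lt _ _ (fun j x => R j -> ~ B' j x)) => j jn.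
  have [Rj|nRj] := pselect (R j); last by apply: filterS filterT => x _ /nRj.
  apply: (@filterS _ _ _ (~` B' j)); first by move=> x.
  apply: ultra_notin; apply: (B'P j Rj).2 => // nj; by rewrite nj ltnn in jn.
move=> i j x Ri Rj [Bi nBi] [Bj nBj].
by case: (ltngtP i j) => // [ij|ji]; [case: (nBj i ij Ri)|case: (nBi j ji Rj)].
Qed.

Lemma contour_RK_equiv_fmap k (p : set_system nat) (p_ : nat -> set_system nat)
    (f : nat -> nat) :
  UltraFilter p -> free_filter p -> RK_minimal p ->
  (forall n, UltraFilter (p_ n)) -> (forall n, free_filter (p_ n)) ->
  (forall n, small_images k.+1 (p_ n)) ->
  (forall n, RK_ge (f @ p_ n) (p_ n) \/ small_images k (f @ p_ n)) ->
  ~ small_images k.+1 (f @ contour p p_) ->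
  RK_equiv (contour p p_) (f @ contour p p_).
Proof.
move=> pp pf pmin pu ppn pk pf_ nk; pose q n := f @ p_ n.
have qu n : UltraFilter (q n) by apply: fmap_ultra.
have uu := contour_ultra pp pu.
have [pS|pS] := in_ultra_setVsetC [set n | RK_ge (q n) (p_ n)] pp; last first.
  (* By conversion the image of the contour is the contour of the images, so its rank would be at
     most k + 1. *)
  case: nk; apply: (@contour_small_images p q) => //.
  by apply: filterS pS => n /= nS; case: (pf_ n).
have [n qv|R [E [pR qE Edisj]]] :=
    disjoint_refinement pp pf pmin qu (contour_ultra pp qu).
  (* If the limit were some [q n], it would inherit the rank bound of [p_ n]. *)
  by apply: nk; rewrite -[f @ _]/(contour p q) -qv; exact: small_images_fmap.
have /choice[A AP] : forall n, exists A, RK_ge (q n) (p_ n) ->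
    p_ n A /\ forall x y, A x -> A y -> f x = f y -> x = y.
  move=> n; have [qp|nqp] := pselect (RK_ge (q n) (p_ n)); last by exists set0.
  by have [A pA Ainj] := RK_ge_fmap_inj (pu n) (ppn n) qp; exists A.
(* Disjointness of the [E n] lets [f x] determine [n], and [f] is injective on each [A n]. *)
pose V := [set x | exists n, [/\ R n, RK_ge (q n) (p_ n), E n (f x) & A n x]].
apply: (@inj_RK_equiv _ uu f V).
  apply/(contourP _ pp); apply: filterS (filterI pR pS) => n [Rn qp].
  have pfE : p_ n (f @^-1` E n) := qE n Rn.
  apply: filterS (filterI pfE (AP n qp).1) => x [Ex Ax].
  by exists n.
move=> x y [i [Ri qpi Ex Ax]] [j [Rj qpj Ey Ay]] fxy.
have ij : i = j by apply: (Edisj i j (f x)) => //; rewrite fxy.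
by rewrite -ij in Ay; exact: (AP i qpi).2.
Qed.

Theorem theorem4p8 (D : ord -> Prop) (hD : D = any_ord \/ D = omega_power)
    (m : nat) (p_ : nat -> set_system nat) (p : set_system nat)
    (pn_disc : discrete_filters p_)
    (pn_free : forall n, UltraFilter (p_ n) /\ free_filter (p_ n))
    (pn_min : forall n, ordinal_RK_minimal D (nat_ord m) (p_ n))
    (p_ultra : UltraFilter p) (p_free : free_filter p)
    (p_RK : RK_minimal p) :
  ordinal_RK_minimal D (nat_ord m.+1) (contour p p_).
Proof.
case: hD pn_min => -> pn_min.
  by case: (J_star_any_omega_power (pn_min 0%N).1).
have pu n := (pn_free n).1; have ppn n := (pn_free n).2.
have Jn n := (J_star_omega_powerP m (pu n)).1 (pn_min n).1.
(* No ultrafilter has rank 0; after this split the [p_ n] have rank m + 1 and the contour is to have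
   rank m + 2. *)
case: m pn_min Jn => [|m] pn_min Jn.
  by have := pu 0%N => p0; case: (small_images0 _ (Jn 0%N).1).
have uu : UltraFilter (contour p p_) := contour_ultra p_ultra pu.
have Su : small_images m.+2 (contour p p_).
  apply: contour_small_images => //.
  by apply: filterS filterT => n _; exact: (Jn n).1.
have nSu : ~ small_images m.+1 (contour p p_).
  by apply: contour_not_small_images => // n; apply: (Jn n).2.
split.
  apply/J_star_omega_powerP; split => // j; rewrite ltnS => jm Sj.
  apply: nSu => f; have [U uU fU] := Sj f; exists U => //.
  exact: small_le jm fU.
move=> f; have [Sf|nSf] := pselect (small_images m.+1 (f @ contour p p_)).
  right; have vu : UltraFilter (f @ contour p p_) := fmap_ultra f uu.
  have exS : exists k, `[< small_images k (f @ contour p p_) >].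
    by exists m.+1; apply/asboolP.
  (* The exponent is the exact rank of the image, the least [k] that works. *)
  case: (ex_minnP exS) => k /asboolP Sk kmin; exists (nat_ord k).
    by apply: nat_ord_lt; rewrite ltnS; apply: kmin; apply/asboolP.
  apply/J_star_omega_powerP; split => // j jk /asboolP /kmin.
  by rewrite leqNgt jk.
left; apply: (@contour_RK_equiv_fmap m) => // n; first exact: (Jn n).1.
(* In the second case [b] has exactly [k] elements with k at most m, so the image of [p_ n] has rank
   at most m. *)
have [[_ RK]|[b /ord_lt_nat_ord[k [km hk nk]] [Jb _]]] := (pn_min n).2 f; first by left.
right => g; have [U uU gU] := (J_omega_powP (fmap_ultra f (pu n)) hk nk).1 Jb g.
by exists U => //; apply: small_le gU; rewrite -ltnS.
Qed.
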